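(* Let $f:G\to H$ be a group isomorphism and let $\mu$ be an $L$-subgroup of $G$. Then $f(\Phi(\mu))\subseteq\Phi(f(\mu))$.
   Context: $L$ is a completely distributive (complete) lattice with least element $0$ and greatest element $1$; $G$ and $H$ are groups. An $L$-subset of $G$ is a function $G\to L$; $\eta\subseteq\mu$ means $\eta(x)\le\mu(x)$ for all $x$; intersections of $L$-subsets are pointwise meets. An $L$-subset $\mu$ of $G$ is an $L$-subgroup of $G$ if $\mu(xy)\ge\mu(x)\wedge\mu(y)$ and $\mu(x^{-1})=\mu(x)$ for all $x,y\in G$. For an $L$-subgroup $\mu$, $L(\mu)$ is the set of $L$-subgroups $\eta$ of the same group with $\eta\subseteq\mu$ (called $L$-subgroups of $\mu$). An $\eta\in L(\mu)$ is proper if $\eta$ is non-constant and $\eta\neq\mu$. A proper $L$-subgroup $\eta$ of $\mu$ is a maximal $L$-subgroup of $\mu$ if whenever $\eta\subseteq\theta\subseteq\mu$ with $\theta\in L(\mu)$, then $\theta=\eta$ or $\theta=\mu$. The Frattini $L$-subgroup $\Phi(\mu)$ is the intersection of all maximal $L$-subgroups of $\mu$, with $\Phi(\mu)=\mu$ if $\mu$ has no maximal $L$-subgroups. For $f:G\to H$, the image of an $L$-subset $\mu$ of $G$ is the $L$-subset of $H$ given by $f(\mu)(y)=\bigvee_{x\in f^{-1}(y)}\mu(x)$ (equal to $0$ if $f^{-1}(y)=\emptyset$). *)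

(* Defs.v *)
From HB Require Import structures.
From mathcomp Require Import all_boot all_order.
From mathcomp Require Import boolp classical_sets.

Set Implicit Arguments.
Unset Strict Implicit.
Unset Printing Implicit Defensive.

Import Order.TTheory.
Local Open Scope classical_set_scope.

Section CompleteLattices.
Context {d : Order.disp_t} (L : tbLatticeType d).

Definition complete_lattice : Prop :=
  forall A : set L, supremums A !=set0 /\ infimums A !=set0.

(* The library's [supremum x0 A] and [infimum x0 A] return [x0] when [A] is
   empty (or when the bound does not exist, which completeness excludes); the
   defaults below are the actual join and meet of the empty set. *)
Definition bigjoin (A : set L) : L := supremum \bot%O A.
Definition bigmeet (A : set L) : L := infimum \top%O A.

(* [c] ranges over the choice functions of the family [J]. *)
Definition completely_distributive : Prop :=
  forall (I : Type) (J : I -> set L),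
    bigmeet [set bigjoin (J i) | i in [set: I]] =
    bigjoin [set bigmeet (range c) | c in [set c : I -> L | forall i, J i (c i)]].

End CompleteLattices.

Section LSubgroups.
Context {d : Order.disp_t} {L : tbLatticeType d} {G : groupType}.
Implicit Types (eta theta mu : G -> L) (S : set (G -> L)).

Definition Lsubset eta mu : Prop := forall x, (eta x <= mu x)%O.

Definition Linter S : G -> L := fun x => bigmeet [set eta x | eta in S].

Definition Lsubgroup mu : Prop :=
  (forall x y, (Order.meet (mu x) (mu y) <= mu (x * y)%g)%O) /\
  (forall x, mu (x^-1)%g = mu x).

Definition Lsubgroup_of mu eta : Prop := Lsubgroup eta /\ Lsubset eta mu.

Definition Lproper mu eta : Prop :=
  [/\ Lsubgroup_of mu eta, ~ (exists a, forall x, eta x = a) & eta <> mu].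

Definition Lmaximal mu eta : Prop :=
  Lproper mu eta /\
  (forall theta, Lsubgroup_of mu theta ->
     Lsubset eta theta -> Lsubset theta mu -> theta = eta \/ theta = mu).

Definition Frattini mu : G -> L :=
  if [set eta | Lmaximal mu eta] == set0 then mu
  else Linter [set eta | Lmaximal mu eta].

End LSubgroups.

Definition Limage {d : Order.disp_t} {L : tbLatticeType d} {G H : Type}
    (f : G -> H) (mu : G -> L) : H -> L :=
  fun y => bigjoin (mu @` (f @^-1` [set y])).

(* Main.v *)
Require Import Defs.
From mathcomp Require Import all_boot all_order.
From mathcomp Require Import boolp classical_sets.

(** Along a bijective homomorphism [f], composition with [f] carries maximal
    [L]-subgroups of [f(mu)] to maximal [L]-subgroups of [mu].  Hence
    [Phi(mu)(x)] lies below [nu(f x)] for every maximal [nu] of [f(mu)];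
    if there is no such [nu], the inclusion is just [Phi(mu) <= mu]. *)

Set Implicit Arguments.
Unset Strict Implicit.
Unset Printing Implicit Defensive.

Import Order.TTheory.
Local Open Scope classical_set_scope.

Section Bounds.
Context {d : Order.disp_t} {L : tbLatticeType d}.
Hypothesis L_complete : complete_lattice L.

(** On a nonempty set [infimum] chooses an element of [infimums A], and completeness makes that set
    inhabited. *)
Lemma bigmeetP (A : set L) : A !=set0 -> infimums A (bigmeet A).
Proof.
move=> /set0P/negbTE A_neq0; rewrite /bigmeet /infimum A_neq0.
by apply: xgetPex; have [] := L_complete A.
Qed.

Lemma bigmeet_le (A : set L) (a : L) : A a -> (bigmeet A <= a)%O.
Proof. by move=> Aa; have [] := @bigmeetP A; [exists a | move=> + _; apply]. Qed.

Lemma le_bigmeet (A : set L) (b : L) :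
  A !=set0 -> (forall a, A a -> (b <= a)%O) -> (b <= bigmeet A)%O.
Proof. by move=> /bigmeetP[_ +] bA; apply. Qed.

Lemma Frattini_le_maximal (G : groupType) (mu eta : G -> L) :
  Lmaximal mu eta -> Lsubset (Frattini mu) eta.
Proof.
move=> eta_max x; rewrite /Frattini ifF; first by apply: bigmeet_le; exists eta.
by apply/negbTE/set0P; exists eta.
Qed.

(** Either no maximal [L]-subgroup exists and both sides coincide, or any maximal one lies between
    them. *)
Lemma Frattini_le (G : groupType) (mu : G -> L) : Lsubset (Frattini mu) mu.
Proof.
have [max0|/set0P[eta eta_max] x] := eqVneq [set eta | Lmaximal mu eta] set0.
  by move=> x; rewrite /Frattini max0 eqxx.
apply: le_trans (Frattini_le_maximal eta_max x) _.
by have [[[_ eta_mu] _ _] _] := eta_max.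
Qed.

(** The bound by [mu] settles the case without maximal [L]-subgroups; otherwise [Frattini mu] is a
    genuine meet over a nonempty family. *)
Lemma le_Frattini (G : groupType) (mu eta : G -> L) :
  Lsubset eta mu -> (forall theta, Lmaximal mu theta -> Lsubset eta theta) ->
  Lsubset eta (Frattini mu).
Proof.
move=> eta_mu eta_max x; rewrite /Frattini; case: ifPn => // /set0P[nu nu_max].
apply: le_bigmeet => [|_ [theta theta_max <-]]; last exact: eta_max.
by exists (nu x), nu.
Qed.

End Bounds.

(** Each fiber of [f] is the singleton of [g y], so the join has a single term. *)
Lemma Limage_comp {d : Order.disp_t} {L : tbLatticeType d} (G H : Type)
    (f : G -> H) (g : H -> G) (mu : G -> L) :
  cancel f g -> cancel g f -> Limage f mu = mu \o g.
Proof.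
move=> fK gK; apply/funext => y.
have fiberE : f @^-1` [set y] = [set g y].
  by apply/seteqP; split => x /= => [<-|->]; rewrite ?fK ?gK.
by rewrite /Limage fiberE image_set1 /bigjoin supremum1.
Qed.

Section Pullback.
Context {d : Order.disp_t} {L : tbLatticeType d} {G H : groupType}.
Variables (f : {multiplicative G -> H}) (g : H -> G).
Hypotheses (fK : cancel f g) (gK : cancel g f).
Implicit Types nu theta : H -> L.

(* The library's [gmulfV] needs a unital morphism; for groups, multiplicativity
   alone suffices. *)
Lemma multiplicativeV x : f (x^-1)%g = (f x)^-1%g.
Proof.
have f1 : f 1%g = 1%g by apply: (mulgI (f 1%g)); rewrite -gmulfM !mulg1.
by apply: (mulgI (f x)); rewrite -gmulfM !mulgV.
Qed.

Lemma Lsubgroup_comp nu : Lsubgroup (nu \o f) <-> Lsubgroup nu.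
Proof.
split=> -[nuM nuV]; split.
(* Descending to [H] uses surjectivity: each element is the image under [f] of its value under
   [g]. *)
- by move=> x y; have := nuM (g x) (g y); rewrite /= gmulfM !gK.
- by move=> x; have := nuV (g x); rewrite /= multiplicativeV gK.
- by move=> x y; rewrite /= gmulfM; apply: nuM.
- by move=> x; rewrite /= multiplicativeV; apply: nuV.
Qed.

Lemma Lsubset_comp theta nu :
  Lsubset (theta \o f) (nu \o f) <-> Lsubset theta nu.
Proof. by split=> sub x; [have := sub (g x); rewrite /= gK | apply: sub]. Qed.

(** Every [L]-subset of [G] factors through [f], as [(eta \o g) \o f]. An intermediate [eta] thus
    descends to [H], where the maximality of [theta] decides it. *)
Lemma Lmaximal_comp theta nu :
  Lmaximal nu theta -> Lmaximal (nu \o f) (theta \o f).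
Proof.
have compK (eta : G -> L) : (eta \o g) \o f = eta.
  by apply/funext => x /=; rewrite fK.
have comp_inj (eta zeta : H -> L) : eta \o f = zeta \o f -> eta = zeta.
  by move=> e; apply/funext => y; rewrite -(gK y); apply: (congr1 (@^~ (g y)) e).
move=> [[[theta_sub theta_nu] theta_nconst theta_neq] theta_max].
split; first split.
- by split; [apply/Lsubgroup_comp | apply/Lsubset_comp].
- move=> [a theta_a]; apply: theta_nconst; exists a => y.
  by rewrite -(gK y); apply: theta_a.
- by move/comp_inj.
- move=> eta; rewrite -(compK eta).
  move=> [/Lsubgroup_comp eta_sub _] /Lsubset_comp theta_eta /Lsubset_comp eta_nu.
  by have [] := theta_max (eta \o g) _ theta_eta eta_nu => // ->; [left | right].
Qed.

End Pullback.

Theorem theorem4p10 (d : Order.disp_t) (L : tbLatticeType d)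
    (L_complete : complete_lattice L) (L_cd : completely_distributive L)
    (G H : groupType) (f : {multiplicative G -> H}) (f_bij : bijective f)
    (mu : G -> L) (mu_Lsubgroup : Lsubgroup mu) :
  Lsubset (Limage f (Frattini mu)) (Frattini (Limage f mu)).
Proof.
have [g fK gK] := f_bij; rewrite !(Limage_comp _ fK gK).
apply: (le_Frattini L_complete) => [y|nu nu_max y]; first exact: Frattini_le.
(* Pulling [nu] back along [f] thus gives a maximal [L]-subgroup of [mu] itself, whose value at
   [g y] is [nu y]. *)
have muE : (mu \o g) \o f = mu by apply/funext => x /=; rewrite fK.
have := Lmaximal_comp fK gK nu_max; rewrite muE.
by move/(Frattini_le_maximal L_complete)/(_ (g y)); rewrite /= gK.
Qed.
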